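(* For any positive integer $k$, $gr_{k}^{*}(K_{3}: P_{4})=k$.
   Context: $P_4$ is the path on 4 vertices. A $k$-edge-coloring uses colors from $[k]=\{1,\ldots,k\}$. A subgraph is monochromatic if all its edges have the same color and rainbow if no two of its edges have the same color. The Gallai-Ramsey number $gr_k(K_3: H)$ is the smallest integer $n$ such that every $k$-edge-colored $K_n$ contains either a rainbow $K_3$ or a monochromatic copy of $H$. For $n=gr_k(K_3:H)$ and $0\le s\le n-1$, $K_{n-1}\sqcup K_{1,s}$ denotes the graph obtained from $K_{n-1}$ by adding a new vertex $v$ and $s$ edges joining $v$ to $s$ vertices of $K_{n-1}$. The star-critical Gallai-Ramsey number $gr_k^{*}(K_3: H)$ is the smallest integer $s$ such that every $k$-edge-colored $K_{n-1}\sqcup K_{1,s}$ contains either a rainbow $K_3$ or a monochromatic copy of $H$. (It is known that $gr_k(K_3:P_4)=k+3$.) *)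

(* Defs.v *)
From mathcomp Require Import all_boot.

Set Implicit Arguments.
Unset Strict Implicit.
Unset Printing Implicit Defensive.

Record sgraph := SGraph {
  vertex :> finType;
  adj : rel vertex;
  adj_sym : symmetric adj;
  adj_irrefl : irreflexive adj }.

Definition edges (G : sgraph) : {set {set G}} :=
  [set [set p.1; p.2] | p : G * G & adj p.1 p.2].

Lemma neq_sym (T : eqType) : symmetric (fun x y : T => x != y).
Proof. by move=> x y; rewrite eq_sym. Qed.

Lemma neq_irrefl (T : eqType) : irreflexive (fun x y : T => x != y).
Proof. by move=> x; rewrite eqxx. Qed.

Definition complete_graph (n : nat) : sgraph :=
  SGraph (@neq_sym 'I_n) (@neq_irrefl 'I_n).

Definition path_adj (n : nat) : rel 'I_n :=
  fun i j => (i.+1 == j :> nat) || (j.+1 == i :> nat).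

Lemma path_adj_sym n : symmetric (@path_adj n).
Proof. by move=> i j; rewrite /path_adj orbC. Qed.

Lemma path_adj_irrefl n : irreflexive (@path_adj n).
Proof. by move=> i; rewrite /path_adj orbb eqn_leq ltnn. Qed.

Definition path_graph (n : nat) : sgraph :=
  SGraph (@path_adj_sym n) (@path_adj_irrefl n).

(* K_m |_| K_{1,s} for s <= m: the added vertex is None. All choices of the s
   neighbours of None give isomorphic graphs; we take the first s vertices. *)
Definition add_star_adj (m s : nat) : rel (option 'I_m) :=
  fun x y => match x, y with
    | Some i, Some j => i != j
    | None, Some i | Some i, None => i < s
    | None, None => false
    end.

Lemma add_star_adj_sym m s : symmetric (@add_star_adj m s).
Proof. by move=> [i|] [j|] //=; rewrite eq_sym. Qed.

Lemma add_star_adj_irrefl m s : irreflexive (@add_star_adj m s).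
Proof. by move=> [i|] //=; rewrite eqxx. Qed.

Definition complete_add_star (m s : nat) : sgraph :=
  SGraph (@add_star_adj_sym m s) (@add_star_adj_irrefl m s).

(* Colours are 1, ..., k, not all necessarily used. Only the values of c on
   edges of G are meaningful. *)
Definition edge_coloring (k : nat) (G : sgraph) (c : {set G} -> nat) : Prop :=
  forall e, e \in edges G -> 1 <= c e <= k.

(* A copy of H in G is a not necessarily induced subgraph of G isomorphic to H,
   given by an embedding. *)
Definition embedding (H G : sgraph) (f : H -> G) : Prop :=
  injective f /\ (forall x y, adj x y -> adj (f x) (f y)).

Definition has_monochromatic (H G : sgraph) (c : {set G} -> nat) : Prop :=
  exists f : H -> G, embedding f /\
    forall e1 e2, e1 \in edges H -> e2 \in edges H ->
      c (f @: e1) = c (f @: e2).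

Definition has_rainbow (H G : sgraph) (c : {set G} -> nat) : Prop :=
  exists f : H -> G, embedding f /\
    forall e1 e2, e1 \in edges H -> e2 \in edges H -> e1 != e2 ->
      c (f @: e1) <> c (f @: e2).

Definition gallai_ramsey_arrow (k : nat) (H G : sgraph) : Prop :=
  forall c : {set G} -> nat, edge_coloring k c ->
    has_rainbow (complete_graph 3) c \/ has_monochromatic H c.

Definition is_smallest (P : nat -> Prop) (n : nat) : Prop :=
  P n /\ forall m, P m -> n <= m.

(* gr_k(K_3 : H) = n *)
Definition is_gallai_ramsey (k : nat) (H : sgraph) (n : nat) : Prop :=
  is_smallest (fun m => gallai_ramsey_arrow k H (complete_graph m)) n.

(* gr_k^*(K_3 : H) = s *)
Definition is_star_critical_gallai_ramsey (k : nat) (H : sgraph) (s : nat) :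
    Prop :=
  exists n, is_gallai_ramsey k H n /\
    is_smallest (fun t => t <= n.-1 /\
      gallai_ramsey_arrow k H (complete_add_star n.-1 t)) s.

(* Main.v *)
(** The colouring of K_{k+2} that avoids both subgraphs is nested: k-1 vertices
    v_1, ..., v_{k-1} are successively joined to everything after them in a
    private colour, and the last three vertices span a triangle in the remaining
    colour. A further vertex may be joined to each v_i in the colour of v_i, so
    k-1 extra edges do not suffice.

    Conversely, a complete graph on at least three vertices with no rainbow
    triangle and no monochromatic P_4 has a vertex v all of whose edges have the
    same colour. If v has at least three neighbours, this colour occurs neither
    away from v in the complete graph nor on the edges from the added vertex to
    the other vertices, since it would extend to a P_4 through v. Deleting v thus
    removes one colour, one vertex and at most one of the k added edges, and
    induction on k leads to a single colour, where a P_4 is immediate. *)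

Require Import Defs.
From mathcomp Require Import all_boot.
From mathcomp Require Import zify.
From Stdlib Require Import Classical.

Set Implicit Arguments.
Unset Strict Implicit.

(** * Copies of [P_4] and [K_3] as tuples of vertices *)

Lemma edgesP (G : sgraph) (e : {set G}) :
  reflect (exists x y, adj x y /\ e = [set x; y]) (e \in edges G).
Proof.
apply: (iffP imsetP) => [[[x y]]|[x [y [xy ->]]]].
  by rewrite inE => xy ->; exists x, y.
by exists (x, y); rewrite ?inE.
Qed.

Lemma mem_edges (G : sgraph) (x y : G) : adj x y -> [set x; y] \in edges G.
Proof. by move=> xy; apply/edgesP; exists x, y. Qed.

Lemma imset_pair (T U : finType) (f : T -> U) (x y : T) :
  f @: [set x; y] = [set f x; f y].
Proof. by rewrite imsetU1 imset_set1. Qed.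

Lemma adj_neq (G : sgraph) (x y : G) : adj x y -> x != y.
Proof. by apply: contraTneq => ->; rewrite adj_irrefl. Qed.

Lemma has_monochromatic_P4 (G : sgraph) (c : {set G} -> nat) :
  has_monochromatic (path_graph 4) c <->
  exists x y z t, [/\ uniq [:: x; y; z; t], [/\ adj x y, adj y z & adj z t],
    c [set x; y] = c [set y; z] & c [set y; z] = c [set z; t]].
Proof.
split=> [[f [[f_inj f_adj] f_col]]|[x [y [z [t [Uxyzt [xy yz zt] exy eyz]]]]]].
  pose v i : path_graph 4 := inord i.
  have v_adj i : i < 3 -> adj (v i) (v i.+1).
    by move=> lti; rewrite /= /path_adj !inordK ?eqxx //; lia.
  exists (f (v 0)), (f (v 1)), (f (v 2)), (f (v 3)); split.
  - rewrite -[[:: _; _; _; _]]/(map f [seq v i | i <- iota 0 4]).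
    rewrite map_inj_uniq // map_inj_in_uniq ?iota_uniq // => i j.
    rewrite !mem_iota => lti ltj /(congr1 val).
    by rewrite /= !inordK.
  - by split; apply: f_adj; apply: v_adj.
  - by rewrite -!(imset_pair f); apply: f_col; apply: mem_edges; apply: v_adj.
  - by rewrite -!(imset_pair f); apply: f_col; apply: mem_edges; apply: v_adj.
exists (fun i : 'I_4 => nth x [:: x; y; z; t] i); split; first split.
- move=> i j /eqP; rewrite nth_uniq ?ltn_ord // => /eqP; exact: val_inj.
- move=> [[|[|[|[|i]]]] lti] [[|[|[|[|j]]]] ltj] //= _; rewrite adj_sym //.
- have col (e : {set path_graph 4}) : e \in edges (path_graph 4) ->
    c ((fun i : 'I_4 => nth x [:: x; y; z; t] i) @: e) = c [set x; y].
    case/edgesP=> i [j [ij ->]]; rewrite imset_pair.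
    by move: i j ij => [[|[|[|[|i]]]] lti] [[|[|[|[|j]]]] ltj] //= _;
      rewrite ?[[set _; x]]setUC ?[[set z; y]]setUC ?[[set t; z]]setUC; congruence.
  by move=> e1 e2 /col -> /col ->.
Qed.

Lemma has_rainbow_K3 (G : sgraph) (c : {set G} -> nat) :
  has_rainbow (complete_graph 3) c <->
  exists x y z, [/\ adj x y, adj y z & adj x z] /\
    uniq [:: c [set x; y]; c [set y; z]; c [set x; z]].
Proof.
split=> [[f [[f_inj f_adj] f_col]]|[x [y [z [[xy yz xz] U]]]]].
  pose v i : complete_graph 3 := inord i.
  have v_neq i j : i < 3 -> j < 3 -> i != j -> v i != v j.
    by move=> lti ltj; rewrite -val_eqE /= !inordK.
  have col i j l : i < 3 -> j < 3 -> l < 3 -> uniq [:: i; j; l] ->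
      c [set f (v i); f (v j)] <> c [set f (v j); f (v l)].
    rewrite /= !inE negb_or => lti ltj ltl /and3P[/andP[ij il] jl _].
    rewrite -!(imset_pair f); apply: f_col; try by apply: mem_edges; apply: v_neq.
    apply/eqP => /setP/(_ (v i)).
    by rewrite !inE eqxx (negbTE (v_neq _ _ _ _ ij)) ?(negbTE (v_neq _ _ _ _ il)).
  exists (f (v 0)), (f (v 1)), (f (v 2)); split.
    by split; apply: f_adj; apply: v_neq.
  rewrite /= !inE negb_or !andbT; apply/andP; split; first apply/andP; first split.
  - by apply/eqP; apply: col.
  - by rewrite [[set f (v 0); f (v 1)]]setUC; apply/eqP; apply: col.
  - by rewrite [[set f (v 0); _]]setUC; apply/eqP; apply: col.
have nxy := adj_neq xy; have nyz := adj_neq yz; have nxz := adj_neq xz.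
exists (fun i : 'I_3 => nth x [:: x; y; z] i); split; first split.
- move=> i j /eqP; rewrite nth_uniq ?ltn_ord //; last by rewrite /= !inE negb_or nxy nxz nyz.
  by move=> /eqP; exact: val_inj.
- by move=> [[|[|[|i]]] lti] [[|[|[|j]]] ltj] //= _; rewrite // adj_sym.
- move=> e1 e2 /edgesP[i [j [ij ->]]] /edgesP[i' [j' [ij' ->]]].
  move: U; rewrite /= !inE negb_or !andbT => /andP[/andP[/eqP n1 /eqP n2] /eqP n3].
  rewrite !imset_pair.
  (* In each case either both edges are the same pair, in equal or opposite order, against
     [e1 != e2], or [n1], [n2], [n3] separate their colours. *)
  have ext (a b a' b' : 'I_3) : val a = val a' -> val b = val b' ->
    [set a; b] = [set a'; b'] by move=> /val_inj -> /val_inj ->.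
  have extC (a b a' b' : 'I_3) : val a = val b' -> val b = val a' ->
    [set a; b] = [set a'; b'] by move=> /val_inj -> /val_inj ->; rewrite setUC.
  move: i j ij i' j' ij' => [[|[|[|i]]] lti] [[|[|[|j]]] ltj] //= _
    [[|[|[|i']]] lti'] [[|[|[|j']]] ltj'] //= _;
    rewrite ?(setUC [set y] [set x]) ?(setUC [set z] [set x])
            ?(setUC [set z] [set y]);
    solve [ by move/eqP=> []; apply: ext | by move/eqP=> []; apply: extC
          | move=> _; congruence ].
Qed.

(** Colourings pull back along [g], and the copies found in [G] push forward by composition. *)
Lemma gallai_ramsey_arrow_embedding (k : nat) (H G G' : sgraph) (g : G -> G') :
  embedding g -> gallai_ramsey_arrow k H G -> gallai_ramsey_arrow k H G'.
Proof.
move=> [g_inj g_adj] arrG c c_col.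
have comp_emb (F : sgraph) (f : F -> G) : embedding f -> embedding (g \o f).
  by move=> [f_inj f_adj]; split=> [|x y /f_adj/g_adj //]; apply: inj_comp.
case: (arrG (fun e => c (g @: e)))
  => [e /edgesP[x [y [xy ->]]]|[f [f_emb f_col]]|[f [f_emb f_col]]].
- by rewrite imset_pair; apply/c_col/mem_edges/g_adj.
- by left; exists (g \o f); split=> [|e1 e2];
    [apply: comp_emb | rewrite !(imset_comp g f); apply: f_col].
- by right; exists (g \o f); split=> [|e1 e2];
    [apply: comp_emb | rewrite !(imset_comp g f); apply: f_col].
Qed.

(** * Lower bound: the nested colouring *)

(* [r] ranks the star centres, the outermost highest, and vanishes elsewhere;
   each edge is coloured by its outermost end. *)
Lemma rank_coloring_avoids (G : sgraph) (r : G -> nat)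
    (c := fun e : {set G} => (\max_(x in e) r x).+1) :
  (forall x y, r x = r y -> 0 < r x -> x = y) ->
  (forall x y z t, uniq [:: x; y; z; t] -> adj x y -> adj y z -> adj z t ->
     0 < r x + r y + r z + r t) ->
  ~ (has_rainbow (complete_graph 3) c \/ has_monochromatic (path_graph 4) c).
Proof.
move=> r_inj r_P4.
have cE x y : adj x y -> c [set x; y] = (maxn (r x) (r y)).+1.
  by move=> /adj_neq xy; rewrite /c big_setU1 ?inE // big_set1.
case=> [/has_rainbow_K3[x [y [z [[xy yz xz]]]]]|].
  (* Two edges of a triangle meet at a vertex of largest rank and so share a colour. *)
  by rewrite !cE //= !inE; lia.
case/has_monochromatic_P4=> x [y [z [t [U [xy yz zt]]]]].
have := r_P4 _ _ _ _ U xy yz zt; rewrite !cE //.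
move: U; rewrite /= !inE !negb_or => /and4P[/and3P[_ nxz nxt] /andP[_ nyt] _ _].
have := adj_neq yz => nyz.
(* The outer edges of the path are disjoint, so their common maximal rank is attained at two
   vertices and must be 0, against [r_P4]. *)
have ne u v : u != v -> r u = r v -> r u = 0.
  by move=> uv ruv; case: (posnP (r u)) => // /(r_inj _ _ ruv) E; rewrite E eqxx in uv.
move: (ne _ _ nxz) (ne _ _ nxt) (ne _ _ nyz) (ne _ _ nyt); lia.
Qed.

(** With [t = 0] this also bounds the Gallai-Ramsey number from below, hence the general [m]. *)
Lemma complete_add_star_not_arrow (k m t : nat) :
  m <= k.+2 -> t < k ->
  ~ gallai_ramsey_arrow k (path_graph 4) (complete_add_star m t).
Proof.
move=> lemk ltk arr.
pose r (x : complete_add_star m t) := if x is Some i then k.-1 - i else 0.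
apply: (@rank_coloring_avoids (complete_add_star m t) r) (arr _ _).
- by move=> [i|] [j|] //= E r_gt0; try lia; congr Some; apply: val_inj => /=; lia.
(* Neighbours of the added vertex have positive rank, so only paths inside the clique remain; there
   rank 0 leaves at most the three indices [k.-1], [k] and [k.+1]. *)
- have r_None i : i < t -> 0 < k.-1 - i by lia.
  move=> [x|] [y|] [z|] [u|] //=; rewrite ?inE ?andbF // => U xy yz zu;
    try by move: (r_None _ xy) (r_None _ yz) (r_None _ zu); lia.
  all: try by move: (r_None _ xy); lia.
  all: try by move: (r_None _ yz); lia.
  all: try by move: (r_None _ zu); lia.
  move: U (ltn_ord x) (ltn_ord y) (ltn_ord z) (ltn_ord u).
  have someE (i j : 'I_m) :
    (Some i == Some j :> complete_add_star m t) = (i == j :> nat) by [].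
  rewrite !negb_or !someE; lia.
- move=> e _; rewrite /= ; apply: (@leq_ltn_trans k.-1); last by lia.
  by apply/bigmax_leqP => -[i|] _ //=; lia.
Qed.

(** * Structure of colourings that avoid both subgraphs *)

Section Avoidance.

Variables (G : sgraph) (c : {set G} -> nat).
Hypothesis no_rainbow : ~ has_rainbow (complete_graph 3) c.
Hypothesis no_mono : ~ has_monochromatic (path_graph 4) c.

Let col (x y : G) := c [set x; y].

Let colC x y : col x y = col y x.
Proof. by rewrite /col setUC. Qed.

Let no_P4 x y z t : uniq [:: x; y; z; t] -> adj x y -> adj y z -> adj z t ->
  col x y = col y z -> col y z = col z t -> False.
Proof.
by move=> U xy yz zt e1 e2; apply/no_mono/has_monochromatic_P4; exists x, y, z, t.
Qed.

Let not_rainbow x y z : adj x y -> adj y z -> adj x z ->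
  [|| col x y == col y z, col x y == col x z | col y z == col x z].
Proof.
move=> xy yz xz; apply/negPn/negP => neq; apply/no_rainbow/has_rainbow_K3.
exists x, y, z; split=> //; move: neq; rewrite /col /= !inE !andbT.
by rewrite !negb_or andbA.
Qed.

(** Working with vertex sets of a fixed [G] lets inductions delete vertices without changing the
    graph or the colouring. *)
Definition clique (S : {set G}) := {in S &, forall x y, x != y -> adj x y}.

Lemma clique_sub (S S' : {set G}) : S' \subset S -> clique S -> clique S'.
Proof. by move=> /subsetP sub clS x y /sub xS /sub yS; apply: clS. Qed.

Lemma exists_notin_seq (S : {set G}) (s : seq G) :
  size s < #|S| -> exists2 x, x \in S & x \notin s.
Proof.
move=> lts; case: (boolP [exists x in S, x \notin s]) => [/exists_inP //|].
rewrite negb_exists_in => /forall_inP sub.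
have: #|S| <= #|s| by apply/subset_leq_card/subsetP => x /sub; rewrite negbK.
by move=> /leq_trans/(_ (card_size s)); rewrite leqNgt lts.
Qed.

(** Induction on the size of [S]: when a vertex [w] is put back, either the old centre [v] still
    works or [w] becomes the centre. *)
Lemma exists_monochromatic_star (S : {set G}) :
  clique S -> 2 < #|S| ->
  exists2 v, v \in S & exists d, {in S :\ v, forall x, col v x = d}.
Proof.
move En: #|S| => n; elim: n S En => // n IHn S cardS clS n_gt1.
have [w wS _] : exists2 w, w \in S & w \notin [::].
  by apply: exists_notin_seq; rewrite cardS.
have cardSw : #|S :\ w| = n by move: cardS; rewrite (cardsD1 w) wS; case.
(* In a triangle, two edges of equal colour share a vertex, which is the centre. *)
have [eqn2|n_neq2] := eqVneq n 2.
  have /cards2P[x [y [xy Sxy]]] : #|S :\ w| == 2 by rewrite cardSw eqn2.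
  have S_eq z : (z != w) && (z \in S) = (z == x) || (z == y).
    by move/setP/(_ z): Sxy; rewrite !inE.
  have /andP[xw xS] : (x != w) && (x \in S) by rewrite S_eq eqxx.
  have /andP[yw yS] : (y != w) && (y \in S) by rewrite S_eq eqxx orbT.
  have S_cases z : z \in S -> [|| z == w, z == x | z == y].
    by move=> zS; rewrite -S_eq zS andbT orbN.
  have wx : adj w x by apply: clS; rewrite // eq_sym.
  have wy : adj w y by apply: clS; rewrite // eq_sym.
  have /or3P[] := not_rainbow wx (clS _ _ xS yS xy) wy => /eqP E.
  - exists x => //; exists (col x y) => z; rewrite !inE => /andP[zx /S_cases].
    by rewrite (negbTE zx) /= => /orP[] /eqP -> //; rewrite colC.
  - exists w => //; exists (col w y) => z; rewrite !inE => /andP[zw /S_cases].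
    by rewrite (negbTE zw) /= => /orP[] /eqP ->.
  - exists y => //; exists (col x y) => z; rewrite !inE => /andP[zy /S_cases].
    by rewrite (negbTE zy) /= orbF => /orP[] /eqP ->; rewrite colC.
have [v vSw [d star]] := IHn _ cardSw (clique_sub (subD1set S w) clS) ltac:(lia).
move: vSw; rewrite !inE => /andP[vw vS].
have [eqd|neqd] := eqVneq (col v w) d.
  exists v => //; exists d => x; rewrite !inE => /andP[xv xS].
  by have [-> //|xw] := eqVneq x w; apply: star; rewrite !inE xv xw.
exists w => //; exists (col v w) => x; rewrite !inE => /andP[xw xS].
have [->|xv] := eqVneq x v; first exact: colC.
have vx : col v x = d by apply: star; rewrite !inE xv xw.
have adjwx : adj w x by apply: clS; rewrite // eq_sym.
have adjvx : adj v x by apply: clS; rewrite // eq_sym.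
have /or3P[] := not_rainbow (clS _ _ vS wS vw) adjwx adjvx.
- by move/eqP.
- by rewrite vx (negbTE neqd).
(* If [w x] had colour [d], a fourth vertex [y] would give the path [w x v y] in colour [d]. *)
rewrite vx => /eqP wx; exfalso.
have [y yS] : exists2 y, y \in S & y \notin [:: w; x; v].
  by apply: exists_notin_seq; rewrite cardS /=; lia.
rewrite !inE !negb_or => /and3P[yw yx yv].
have vy : col v y = d by apply: star; rewrite !inE yv yw.
apply: (@no_P4 w x v y).
- by rewrite /= !inE !negb_or ![_ == y]eq_sym yw yx yv [w == x]eq_sym xw [w == v]eq_sym vw xv.
- by apply: clS => //; rewrite eq_sym.
- exact: clS.
- by apply: clS => //; rewrite eq_sym.
- by rewrite wx colC vx.
- by rewrite colC vx vy.
Qed.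

(* The colours range over a list of length [k + 1], so that the induction starts
   at one colour: a star with two leaves would not make its colour disappear. *)
Lemma clique_with_pendant_contradiction (k : nat) (C : seq nat) (w : G)
    (S N : {set G}) :
  size C = k.+1 -> clique S -> k.+2 < #|S| -> w \notin S ->
  N \subset S -> k < #|N| -> {in N, forall x, adj w x} ->
  {in S &, forall x y, x != y -> col x y \in C} ->
  {in N, forall x, col w x \in C} -> False.
Proof.
elim: k C S N => [|k IHk] C S N sizeC clS cardS wS subN cardN adjN colS colN.
  (* With one colour, a neighbour [x] of [w] and two more vertices of [S] give the path
     [w x y z]. *)
  case: C sizeC colS colN => [//|d [|//]] _ colS colN.
  have [x xN _] : exists2 x, x \in N & x \notin [::] by exact: exists_notin_seq.
  have xS := subsetP subN _ xN.
  have [y yS] : exists2 y, y \in S & y \notin [:: x] by apply: exists_notin_seq; apply: ltnW.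
  rewrite inE => yx.
  have [z zS] : exists2 z, z \in S & z \notin [:: x; y] by exact: exists_notin_seq.
  rewrite !inE negb_or => /andP[zx zy].
  have wneq u : u \in S -> w != u by apply: contraTneq => <-.
  have xy : x != y by rewrite eq_sym.
  have yz : y != z by rewrite eq_sym.
  apply: (@no_P4 w x y z); rewrite ?adjN ?clS //.
  - by rewrite /= !inE !negb_or !wneq // xy yz eq_sym zx.
  - move: (colN _ xN) (colS _ _ xS yS xy); rewrite !inE => /eqP -> /eqP -> //.
  - move: (colS _ _ xS yS xy) (colS _ _ yS zS yz); rewrite !inE => /eqP -> /eqP -> //.
have [v vS [d star]] := exists_monochromatic_star clS ltac:(lia).
have wneq u : u \in S -> w != u by apply: contraTneq => <-.
have starS x : x \in S -> x != v -> col v x = d.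
  by move=> xS xv; apply: star; rewrite !inE xv.
(* The vertex [u] need not lie in [S], so this covers both the edges inside [S] and those from
   [w]. *)
have d_notin x u : x \in S -> x != v -> u != x -> u != v -> adj u x -> col u x != d.
  move=> xS xv ux uv adjux; apply/eqP => colux.
  have [y yS] : exists2 y, y \in S & y \notin [:: u; x; v].
    by apply: exists_notin_seq => /=; lia.
  rewrite !inE !negb_or => /and3P[yu yx yv].
  apply: (@no_P4 u x v y) => //.
  - by rewrite /= !inE !negb_or ux uv xv ![_ == y]eq_sym yu yx yv.
  - exact: clS.
  - by apply: clS => //; rewrite eq_sym.
  - by rewrite colux colC starS.
  - by rewrite colC !starS.
have dC : d \in C.
  have [y yS] : exists2 y, y \in S & y \notin [:: v] by apply: exists_notin_seq => /=; lia.
  by rewrite inE => yv; rewrite -(starS y yS yv); apply: colS => //; rewrite eq_sym.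
(* [rem] deletes one occurrence of [d], so [C] may contain repetitions. *)
have memC e : e \in C -> e != d -> e \in rem d C.
  by rewrite (perm_mem (perm_to_rem dC)) inE => /orP[/eqP ->|//]; rewrite eqxx.
apply: (IHk (rem d C) (S :\ v) (N :\ v)).
- by rewrite size_rem // sizeC.
- exact: clique_sub (subD1set S v) clS.
- by move: cardS; rewrite (cardsD1 v) vS; lia.
- by rewrite !inE (negbTE wS) andbF.
- exact: setSD.
- by move: cardN; rewrite (cardsD1 v); lia.
- by move=> x; rewrite !inE => /andP[_]; apply: adjN.
- move=> x y; rewrite !inE => /andP[xv xS] /andP[yv yS] xy.
  by apply: memC; [apply: colS | apply: d_notin => //; apply: clS].
- move=> x; rewrite !inE => /andP[xv xN]; have xS := subsetP subN _ xN.
  by apply: memC; [apply: colN | apply: d_notin => //; rewrite ?wneq ?adjN].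
Qed.

End Avoidance.

(** * Upper bound and conclusion *)

Lemma complete_add_star_arrow (k : nat) :
  0 < k -> gallai_ramsey_arrow k (path_graph 4) (complete_add_star k.+2 k).
Proof.
case: k => // k _; set G := complete_add_star _ _ => c c_col.
apply: NNPP => /not_or_and[no_rainbow no_mono].
pose w : G := None.
have colP x y : adj x y -> c [set x; y] \in iota 1 k.+1.
  by move=> xy; rewrite mem_iota add1n ltnS; apply/c_col/mem_edges.
pose S := [set~ w]; pose N := [set x | adj w x].
have clS : clique S by move=> [i|] [j|]; rewrite !inE.
have adjN : {in N, forall x, adj w x} by move=> x; rewrite inE.
apply: (clique_with_pendant_contradiction no_rainbow no_mono
          (k := k) (C := iota 1 k.+1) (w := w) (S := S) (N := N)) => //.
- by rewrite size_iota.
- by rewrite cardsC1 card_option card_ord.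
- by rewrite !inE eqxx.
- by apply/subsetP => -[i|]; rewrite !inE.
(* The leaves are the first [k.+1] vertices, which gives the required size of [N]. *)
- have inj_leaf : injective (fun i : 'I_k.+1 => Some (widen_ord (leq_addl 2 k.+1) i)).
    by move=> i j [] ij; apply: val_inj.
  rewrite -[X in X <= _]card_ord -(card_imset _ inj_leaf).
  by apply/subset_leq_card/subsetP => _ /imsetP[i _ ->]; rewrite inE /=.
- by move=> x y xS yS xy; apply/colP/clS.
- by move=> x /adjN; apply: colP.
Qed.

Unset Implicit Arguments.

Theorem theorem4p3 (k : nat) (hk : 0 < k) :
  is_star_critical_gallai_ramsey k (path_graph 4) k.
Proof.
exists k.+3; split; split=> /=.
(* The graph with [k] added edges spans [K_{k+3}], so its arrow property passes to the complete
   graph. *)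
- pose g (x : complete_add_star k.+2 k) : complete_graph k.+3 :=
    if x is Some i then widen_ord (leqnSn _) i else ord_max.
  have g_inj : injective g.
    move=> [i|] [j|] // /(congr1 val) /= E; first by congr Some; apply: val_inj.
      by have := ltn_ord i; rewrite E ltnn.
    by have := ltn_ord j; rewrite -E ltnn.
  apply: (@gallai_ramsey_arrow_embedding _ _ _ _ g).
    by split=> // x y /adj_neq xy; rewrite /= (inj_eq g_inj).
  exact: complete_add_star_arrow.
- move=> m arr; rewrite leqNgt; apply/negP => ltm.
  (* An isolated extra vertex turns [K_m] into the case [t = 0]. *)
  apply: (@complete_add_star_not_arrow k m 0) => //.
  have Some_emb : @embedding (complete_graph m) (complete_add_star m 0) Some.
    by split=> // x y [].
  exact: gallai_ramsey_arrow_embedding Some_emb arr.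
- by split; [apply: leqW; apply: leqnSn | apply: complete_add_star_arrow].
- move=> t [_ arr]; rewrite leqNgt; apply/negP => ltt.
  exact: complete_add_star_not_arrow arr.
Qed.
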